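(* Let $g:\mathbb{R}^m\to\mathbb{R}$ be a (not necessarily convex) Fréchet differentiable function whose gradient is $L_g$-Lipschitz continuous, let $\alpha>0$, $\beta\in(0,1)$, $0<s<\frac{2(1-\beta)}{L_g}$, let $x_0,x_{-1}\in\mathbb{R}^m$, and let $(x_n)_{n\in\mathbb{N}},(y_n)_{n\in\mathbb{N}}$ be generated, for all $n\in\mathbb{N}$, by $$y_n=x_n+\frac{\beta n}{n+\alpha}(x_n-x_{n-1}),\qquad x_{n+1}=y_n-s\nabla g(y_n).$$ Assume that $g$ is bounded from below, that the set $\omega((x_n)_{n\in\mathbb{N}})$ of cluster points of $(x_n)$ is nonempty, and that $g$ has the Łojasiewicz property at some $x^*\in\omega((x_n)_{n\in\mathbb{N}})$ with Łojasiewicz exponent $\theta\in\left[\frac12,1\right)$. If $\theta=\frac12$, then there exist $Q\in[0,1)$, $a_1,a_2,a_3,a_4>0$ and $\overline{k}\in\mathbb{N}$ such that for every $n\ge\overline{k}$: (a$_1$) $g(y_n)-g(x^* )\le a_1Q^n$; (a$_2$) $g(x_n)-g(x^* )\le a_2Q^n$; (a$_3$) $\|x_n-x^*\|\le a_3Q^{\frac n2}$; (a$_4$) $\|y_n-x^*\|\le a_4Q^{\frac n2}$. If $\theta\in\left(\frac12,1\right)$, then there exist $b_1,b_2,b_3,b_4>0$ and $\overline{k}\in\mathbb{N}$ such that for all $n\ge\overline{k}$: (b$_1$) $g(y_n)-g(x^* )\le b_1n^{-\frac{1}{2\theta-1}}$; (b$_2$) $g(x_n)-g(x^* )\le b_2n^{-\frac{1}{2\theta-1}}$;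 (b$_3$) $\|x_n-x^*\|\le b_3n^{\frac{\theta-1}{2\theta-1}}$; (b$_4$) $\|y_n-x^*\|\le b_4n^{\frac{\theta-1}{2\theta-1}}$.
   Context: $\mathbb{N}=\{0,1,2,\dots\}$; $\|\cdot\|$ is the Euclidean norm. $L_g$-Lipschitz gradient means: $L_g\ge 0$ and $\|\nabla g(x)-\nabla g(y)\|\le L_g\|x-y\|$ for all $x,y\in\mathbb{R}^m$. A cluster point of a sequence is the limit of one of its subsequences. Łojasiewicz property. A differentiable function $f:\mathbb{R}^d\to\mathbb{R}$ fulfills the Łojasiewicz property at a critical point $\overline{x}$ of $f$ (i.e. $\nabla f(\overline{x})=0$) if there exist $K,\epsilon>0$ and $\theta\in[0,1)$ such that $|f(x)-f(\overline{x})|^\theta\le K\|\nabla f(x)\|$ for every $x$ with $\|x-\overline{x}\|<\epsilon$. The number $\theta$ is called the Łojasiewicz exponent of $f$ at $\overline{x}$. *)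

(* Defs.v *)
From mathcomp Require Import all_boot all_order all_algebra.
From mathcomp Require Import all_classical all_reals all_analysis.

Set Implicit Arguments.
Unset Strict Implicit.
Unset Printing Implicit Defensive.

Import Order.TTheory GRing.Theory Num.Theory.
Import numFieldNormedType.Exports.

Local Open Scope classical_set_scope.
Local Open Scope ring_scope.

(* The norm `|x| of the library on 'rV[R]_m is the
   max norm, hence this definition.  The two norms are equivalent, so the
   topology and Fréchet differentiability on 'rV[R]_m are the usual ones. *)
Definition enorm (R : realType) (m : nat) (u : 'rV[R]_m) : R :=
  Num.sqrt (\sum_(i < m) u 0 i ^+ 2).

(* The vector that represents the Fréchet derivative 'd f x for the Euclidean
   inner product, meaningful where f is differentiable. *)
Definition gradient (R : realType) (m : nat) (f : 'rV[R]_m -> R)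
    (x : 'rV[R]_m) : 'rV[R]_m :=
  \row_(i < m) 'd f x (delta_mx 0 i).

Definition lipschitz_gradient (R : realType) (m : nat) (f : 'rV[R]_m -> R)
    (L : R) : Prop :=
  0 <= L /\
  forall x y, enorm (gradient f x - gradient f y) <= L * enorm (x - y).

Definition cluster_points (R : realType) (m : nat) (x : nat -> 'rV[R]_m) :
    set 'rV[R]_m :=
  [set p | exists phi : nat -> nat,
     {homo phi : i j / (i < j)%N} /\ (fun k => x (phi k)) @ \oo --> p].

(* f has the Łojasiewicz property at its critical point xbar, with exponent
   theta.  For theta = 0, powR gives 0 `^ 0 = 1. *)
Definition lojasiewicz_exponent (R : realType) (m : nat) (f : 'rV[R]_m -> R)
    (xbar : 'rV[R]_m) (theta : R) : Prop :=
  [/\ forall x, differentiable f x,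
      gradient f xbar = 0,
      0 <= theta < 1
    & exists K eps : R, [/\ 0 < K, 0 < eps
        & forall x, enorm (x - xbar) < eps ->
            `|f x - f xbar| `^ theta <= K * enorm (gradient f x)]].

(* n |-> x_{n-1}, where xm1 plays the role of x_{-1} *)
Definition delay (T : Type) (xm1 : T) (x : nat -> T) (n : nat) : T :=
  if n is k.+1 then x k else xm1.

(* Main.v *)
Require Import Defs.
From mathcomp Require Import all_boot all_order all_algebra.
From mathcomp Require Import all_classical all_reals all_analysis.
From mathcomp Require Import ring lra zify.

Import Order.TTheory GRing.Theory Num.Theory.
Import numFieldNormedType.Exports.

Local Open Scope classical_set_scope.
Local Open Scope ring_scope.

(* Put d_n = x_n - x_{n-1} and E_n = g(y_n) + delta |d_n|^2 for a suitable
   delta > 0.  The descent lemma and 2<u,v> <= |u|^2 + |v|^2 give, for large n,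
   E_{n+1} + c u_n^2 <= E_n with u_n = |d_n| + |d_{n+1}|; this is where
   s < 2(1 - beta)/Lg is used.  Hence r_n = E_n - g(xs), with xs the given
   cluster point, decreases to 0.  Since s grad g(y_n) = beta_n d_n - d_{n+1},
   the Lojasiewicz inequality gives r_n^theta <= C u_n while y_n is near xs, and
   by concavity of t^(1-theta), u_n <= H (r_n^(1-theta) - r_{n+1}^(1-theta)).
   Summing, the iterates never leave a neighbourhood of xs once they are close
   enough to it, and |x_n - xs| <= H r_n^(1-theta).  The rates follow from
   r_n - r_{n+1} >= M r_n^(2 theta): geometric decay if theta = 1/2, and
   increments of r_n^(1 - 2 theta) bounded from below if theta > 1/2. *)

(** * Euclidean geometry and the descent lemma *)

Definition dot {R : realType} {m : nat} (u v : 'rV[R]_m) : R :=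
  \sum_(i < m) u 0 i * v 0 i.

Section EuclideanSpace.
Context {R : realType} {m : nat}.
Implicit Types (u v w : 'rV[R]_m) (a b : R).

Lemma dotC u v : dot u v = dot v u.
Proof. by apply: eq_bigr => i _; rewrite mulrC. Qed.

Lemma dotDl u v w : dot (u + v) w = dot u w + dot v w.
Proof. by rewrite -big_split; apply: eq_bigr => i _; rewrite mxE mulrDl. Qed.

Lemma dotZl a u v : dot (a *: u) v = a * dot u v.
Proof. by rewrite mulr_sumr; apply: eq_bigr => i _; rewrite mxE mulrA. Qed.

Lemma dotNl u v : dot (- u) v = - dot u v.
Proof. by rewrite -scaleN1r dotZl mulN1r. Qed.

Lemma dotDr u v w : dot u (v + w) = dot u v + dot u w.
Proof. by rewrite !(dotC u) dotDl. Qed.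

Lemma dotZr a u v : dot u (a *: v) = a * dot u v.
Proof. by rewrite !(dotC u) dotZl. Qed.

Lemma dotNr u v : dot u (- v) = - dot u v.
Proof. by rewrite !(dotC u) dotNl. Qed.

Lemma dot0l u : dot 0 u = 0.
Proof. by rewrite -(scale0r 0) dotZl mul0r. Qed.

Definition dotE := (dotDl, dotDr, dotZl, dotZr, dotNl, dotNr).

Lemma dot_ge0 u : 0 <= dot u u.
Proof. by apply: sumr_ge0 => i _; rewrite -expr2 sqr_ge0. Qed.

Lemma enorm_ge0 u : 0 <= enorm u.
Proof. exact: sqrtr_ge0. Qed.

Lemma sqr_enorm u : enorm u ^+ 2 = dot u u.
Proof.
rewrite /enorm (_ : \sum_i _ = dot u u); first by rewrite sqr_sqrtr ?dot_ge0.
by apply: eq_bigr => i _; rewrite expr2.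
Qed.

Lemma enormZ a u : enorm (a *: u) = `|a| * enorm u.
Proof.
apply: (@pexpIrn _ 2); rewrite ?nnegrE ?mulr_ge0 ?enorm_ge0 //.
by rewrite exprMn !sqr_enorm !dotE real_normK ?num_real // expr2 mulrA.
Qed.

Lemma enormN u : enorm (- u) = enorm u.
Proof. by rewrite -scaleN1r enormZ normrN1 mul1r. Qed.

Lemma enorm_distC u v : enorm (u - v) = enorm (v - u).
Proof. by rewrite -enormN opprB. Qed.

Lemma enorm_eq0 u : enorm u = 0 -> u = 0.
Proof.
move=> u0; apply/rowP => i; rewrite mxE.
have : dot u u = 0 by rewrite -sqr_enorm u0 expr0n.
move/eqP; rewrite psumr_eq0 => [/allP/(_ i)|j _]; last first.
  by rewrite -expr2 sqr_ge0.
by rewrite mem_index_enum => /(_ isT); rewrite mulf_eq0 orbb => /eqP.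
Qed.

(** Cauchy-Schwarz: when both norms are nonzero, expand the square of [enorm v *: u - enorm u *: v],
    which is nonnegative, and cancel the positive factor [enorm u * enorm v]. *)
Lemma dot_le_enorm u v : dot u v <= enorm u * enorm v.
Proof.
have [u0|uN0] := eqVneq (enorm u) 0.
  by rewrite (enorm_eq0 _ u0) -(scale0r 0) dotZl enormZ normr0 !mul0r.
have [v0|vN0] := eqVneq (enorm v) 0.
  by rewrite (enorm_eq0 _ v0) -(scale0r 0) dotZr enormZ normr0 !mul0r mulr0.
have uv_gt0 : 0 < enorm u * enorm v by rewrite mulr_gt0// lt_def enorm_ge0 andbT.
have := dot_ge0 (enorm v *: u - enorm u *: v).
rewrite !dotE (dotC v u) -!sqr_enorm => h.
rewrite -(ler_pM2l uv_gt0); nra.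
Qed.

Lemma enormD u v : enorm (u + v) <= enorm u + enorm v.
Proof.
rewrite -(@ler_pXn2r _ 2) ?nnegrE ?addr_ge0 ?enorm_ge0//.
rewrite sqr_enorm !dotE (dotC v u) -!sqr_enorm.
have := dot_le_enorm u v; nra.
Qed.

Lemma enormB u v : enorm (u - v) <= enorm u + enorm v.
Proof. by rewrite -(enormN v); exact: enormD. Qed.

Lemma enorm_dist_trans w u v : enorm (u - v) <= enorm (u - w) + enorm (w - v).
Proof. by rewrite -{1}(subrK w u) -addrA; exact: enormD. Qed.

Lemma enorm_le_norm u : enorm u <= Num.sqrt m%:R * `|u|.
Proof.
rewrite -(@ler_pXn2r _ 2) ?nnegrE ?mulr_ge0 ?enorm_ge0 ?sqrtr_ge0//.
rewrite sqr_enorm exprMn sqr_sqrtr ?ler0n// mulr_natl -[m in _ *+ m]card_ord.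
rewrite -sumr_const; apply: ler_sum => i _; rewrite -expr2.
rewrite -(real_normK (num_real (u 0 i))) lerXn2r ?nnegrE//.
rewrite /Num.Def.normr /= mx_normrE.
exact: (le_bigmax_cond _ (fun ij => `|u ij.1 ij.2|) (j := (0, i))).
Qed.

(** Transfers convergence in the max-norm topology to the Euclidean norm. *)
Lemma cvg_enorm (z : nat -> 'rV[R]_m) (p : 'rV[R]_m) : z @ \oo --> p ->
  forall e : R, 0 < e -> \forall n \near \oo, enorm (z n - p) < e.
Proof.
move=> zp e e0.
(* The added 1 keeps the divisor positive when [m = 0]. *)
have s0 : 0 < Num.sqrt m%:R + 1 :> R by rewrite ltr_wpDl ?sqrtr_ge0.
move/cvgrPdist_lt: zp => /(_ _ (divr_gt0 e0 s0)); apply: filterS => n.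
rewrite ltr_pdivlMr// enorm_distC; apply: le_lt_trans.
apply: le_trans (enorm_le_norm _) _.
by rewrite mulrC ler_wpM2l// lerDl.
Qed.

Context {g : 'rV[R]_m -> R}.
Hypothesis g_diff : forall z, differentiable g z.

Lemma diff_gradient z v : 'd g z v = dot (gradient g z) v.
Proof.
rewrite [v in LHS]row_sum_delta linear_sum; apply: eq_bigr => i _.
by rewrite linearZ mxE mulrC.
Qed.

Lemma is_derive_line z v (t : R) :
  is_derive t 1 (fun t => g (z + t *: v)) (dot (gradient g (z + t *: v)) v).
Proof.
have lineE : (fun h : R => h^-1 *: (((fun t => g (z + t *: v)) \o shift t) (h *: 1)
      - g (z + t *: v)))
    = (fun h : R => h^-1 *: ((g \o shift (z + t *: v)) (h *: v) - g (z + t *: v))).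
  apply/funext => h /=; congr (_ *: (g _ - _)).
  by rewrite [h *: 1]mulr1 scalerDl addrCA.
have dg := g_diff (z + t *: v).
apply: DeriveDef.
  by rewrite /derivable lineE; exact: (diff_derivable dg).
by rewrite -diff_gradient -deriveE// /derive lineE.
Qed.

(** Mean value theorem for [h], which is [g] along the segment minus the linear and quadratic terms
    of the bound. Cauchy-Schwarz and the Lipschitz condition make its derivative nonpositive on the
    open unit interval, so [h 1 <= h 0]. *)
Lemma descent L z w : lipschitz_gradient g L ->
  g w <= g z + dot (gradient g z) (w - z) + L / 2 * enorm (w - z) ^+ 2.
Proof.
move=> [L0 g_lip]; set v := w - z.
pose h (t : R) := g (z + t *: v)
  - (t * dot (gradient g z) v + t ^+ 2 * (L / 2 * enorm v ^+ 2)).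
pose dh (t : R) := dot (gradient g (z + t *: v)) v
  - (dot (gradient g z) v + t * (L * enorm v ^+ 2)).
have hdh (t : R) : is_derive t 1 h (dh t).
  apply: is_deriveB (is_derive_line z v t) _.
  by apply: is_derive_eq; rewrite /GRing.scale/=; field.
have [c] : exists2 c, c \in `]0, 1[ & h 1 - h 0 = dh c * (1 - 0).
  apply: (@MVT _ h dh) => //.
  apply: continuous_subspaceT => t.
  by apply: differentiable_continuous; apply/derivable1_diffP; case: (hdh t).
rewrite in_itv/= => /andP[c0 _] hE.
suff : h 1 - h 0 <= 0.
  rewrite /h scale1r scale0r addr0 /v subrKC; lra.
rewrite hE subr0 mulr1 /dh.
have := dot_le_enorm (gradient g (z + c *: v) - gradient g z) v.
rewrite dotDl dotNl => /le_trans cs.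
have := g_lip (z + c *: v) z; rewrite [z + _ - z]addrC addKr enormZ gtr0_norm// => lip.
have := cs _ (ler_wpM2r (enorm_ge0 v) lip).
by rewrite subr_le0 -lerBlDl expr2 [L * _]mulrCA !mulrA.
Qed.

(** Descent from [z] gives the upper side with constant [L / 2]. Descent from [w] gives the lower
    side, where the linear term costs a further [L] because the gradient at [w] has norm at most
    [L * enorm (w - z)]. *)
Lemma critical_growth L z w : lipschitz_gradient g L -> gradient g z = 0 ->
  `|g w - g z| <= 3 / 2 * L * enorm (w - z) ^+ 2.
Proof.
move=> g_lip gz0; have [L0 lip] := g_lip.
have up := descent _ z w g_lip; have low := descent _ w z g_lip.
have := lip w z; rewrite gz0 subr0 (enorm_distC w) => gw.
have cs := dot_le_enorm (gradient g w) (z - w).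
have {}cs := le_trans cs (ler_wpM2r (enorm_ge0 _) gw).
have e0 := mulr_ge0 L0 (sqr_ge0 (enorm (z - w))).
move: up; rewrite gz0 dot0l addr0 !(enorm_distC w) => up.
move: up low cs e0; rewrite ler_norml.
move: (g w) (g z) (dot _ _) (enorm _) => a b p e *.
by apply/andP; split; lra.
Qed.
End EuclideanSpace.

(** * Real sequences *)

Section RealSequences.
Context {R : realType}.
Implicit Types (a b c q t u C M p theta lb alpha beta : R) (r : nat -> R).

Lemma ln_le_subr1 t : 0 < t -> ln t <= t - 1.
Proof. by move=> t0; have := expR_ge1Dx (ln t); rewrite lnK ?posrE//; lra. Qed.

Lemma powRD_gt0 t a b : 0 < t -> t `^ (a + b) = t `^ a * t `^ b.
Proof. by move=> t0; rewrite powRD// (gt_eqF t0) implybT. Qed.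

Lemma powR_tangent_le q t : 0 <= q <= 1 -> 0 <= t -> t `^ q <= 1 + q * (t - 1).
Proof.
move=> /andP[q0 q1]; rewrite le_eqVlt => /predU1P[<-|t0].
  have [->|qN0] := eqVneq q 0; first by rewrite powRr0; lra.
  by rewrite powR0//; lra.
have tE z : t `^ z = expR (z * ln t) by rewrite /powR gt_eqF.
have w0 := powR_gt0 q t0.
have tw : t = t `^ q * t `^ (1 - q).
  by rewrite -powRD_gt0// subrKC powRr1// ltW.
have onew : 1 = t `^ q * t `^ (- q).
  by rewrite -powRD_gt0// subrr powRr0.
have h1 := expR_ge1Dx ((1 - q) * ln t); rewrite -tE in h1.
have h2 := expR_ge1Dx (- q * ln t); rewrite -tE in h2.
have k1 : t `^ q * (1 + (1 - q) * ln t) <= t by rewrite [leRHS]tw ler_pM2l.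
have k2 : t `^ q * (1 + - q * ln t) <= 1 by rewrite [leRHS]onew ler_pM2l.
have q1' : 0 <= 1 - q by lra.
have := lerD (ler_wpM2l q0 k1) (ler_wpM2l q1' k2).
move: (t `^ q) (ln t) => w l h; lra.
Qed.

Lemma powRN_tangent_ge p t : 0 <= p -> 0 < t -> 1 - p * (t - 1) <= t `^ (- p).
Proof.
move=> p0 t0; rewrite /powR gt_eqF//; apply: le_trans (expR_ge1Dx _).
by have := ler_wpM2l p0 (ln_le_subr1 t t0); lra.
Qed.

(** The tangent inequality at [b / a], rescaled by [a]. *)
Lemma powR_concave_sub q a b : 0 <= q <= 1 -> 0 < a -> 0 <= b ->
  q * (a - b) <= a `^ (1 - q) * (a `^ q - b `^ q).
Proof.
move=> q01 a0 b0.
have aE : a `^ (1 - q) * a `^ q = a by rewrite -powRD_gt0// subrK powRr1// ltW.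
have := powR_tangent_le q (b / a) q01 (divr_ge0 b0 (ltW a0)).
move/(ler_wpM2l (powR_ge0 a q)); rewrite -(powRM _ (ltW a0) (divr_ge0 b0 (ltW a0)))//.
rewrite mulrCA divff ?gt_eqF// mulr1 => /(ler_wpM2l (powR_ge0 a (1 - q))).
rewrite mulrA aE => h.
have -> : q * (a - b) = - (a * (q * (b / a - 1))) by field; rewrite gt_eqF.
rewrite [leRHS]mulrBr aE; lra.
Qed.

Lemma powRN_convex_sub p a b : 0 <= p -> 0 < a -> 0 < b ->
  p * (a - b) <= a `^ (1 + p) * (b `^ (- p) - a `^ (- p)).
Proof.
move=> p0 a0 b0.
have aE : a `^ (1 + p) * a `^ (- p) = a by rewrite -powRD_gt0// addrK powRr1// ltW.
have := powRN_tangent_ge p (b / a) p0 (divr_gt0 b0 a0).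
move/(ler_wpM2l (powR_ge0 a (- p)));
rewrite -(powRM _ (ltW a0) (divr_ge0 (ltW b0) (ltW a0)))//.
rewrite [in leRHS]mulrCA divff ?gt_eqF// mulr1 => /(ler_wpM2l (powR_ge0 a (1 + p))).
rewrite mulrA aE => h.
have -> : p * (a - b) = - (a * (p * (b / a - 1))) by field; rewrite gt_eqF.
rewrite [leRHS]mulrBr aE; lra.
Qed.

Lemma length_step c C theta u a b : 0 < c -> 0 < C -> 0 <= theta < 1 ->
  0 <= u -> 0 <= a -> 0 <= b -> c * u ^+ 2 <= a - b -> a `^ theta <= C * u ->
  u <= C / (c * (1 - theta)) * (a `^ (1 - theta) - b `^ (1 - theta)).
Proof.
move=> c0 C0 /andP[th0 th1] u0 a0 b0 hu ha.
have th1' : 0 < 1 - theta by rewrite subr_gt0.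
move: u0; rewrite le_eqVlt => /predU1P[<-|u0].
  rewrite mulr_ge0 ?divr_ge0 ?mulr_ge0 ?(ltW th1') ?(ltW c0) ?(ltW C0)// subr_ge0.
  apply: ge0_ler_powR; rewrite ?nnegrE// ?(ltW th1')//.
  by rewrite -subr_ge0 (le_trans _ hu)// mulr_ge0 ?sqr_ge0// ltW.
have {}a0 : 0 < a.
  have := mulr_gt0 c0 (exprn_gt0 2 u0); lra.
have h := powR_concave_sub (1 - theta) a b _ a0 b0.
rewrite subKr in h.
have {}h : (1 - theta) * (c * u ^+ 2) <= C * u * (a `^ (1 - theta) - b `^ (1 - theta)).
  apply: le_trans (ler_wpM2l (ltW th1') hu) _.
  apply: le_trans (h _) _; first by lra.
  apply: ler_wpM2r => //; rewrite subr_ge0.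
  apply: ge0_ler_powR; rewrite ?nnegrE ?(ltW a0)// ?(ltW th1')//.
  by rewrite -subr_ge0 (le_trans _ hu)// mulr_ge0 ?sqr_ge0// ltW.
rewrite mulrAC ler_pdivlMr ?mulr_gt0// -(ler_pM2r u0).
move: h; move: (_ - _ `^ _) => z h; lra.
Qed.

Lemma linear_rate r M (N : nat) : 0 < M -> (forall n, (N <= n)%N -> 0 <= r n) ->
  (forall n, (N <= n)%N -> M * r n <= r n - r n.+1) ->
  exists Q a, [/\ 0 < Q < 1, 0 < a & forall n, (N <= n)%N -> r n <= a * Q ^+ n].
Proof.
(* The maximum with 1/2 keeps [Q] positive even if [1 <= M]; below, [r N + 1] keeps the prefactor
   positive even if [r N = 0]. *)
move=> M0 r0 rM; pose Q := Num.max (1 - M) (1 / 2).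
have Q0 : 0 < Q by rewrite lt_max; apply/orP; right; lra.
have Q1 : Q < 1 by rewrite gt_max; apply/andP; split; lra.
have MQ : 1 - M <= Q by rewrite le_max lexx.
exists Q, ((r N + 1) / Q ^+ N); split; first by rewrite Q0 Q1.
  by rewrite divr_gt0 ?exprn_gt0// ltr_wpDl// r0.
move=> n /subnK <-; elim: (n - N)%N => [|k IHk].
  by rewrite divfK ?expf_neq0 ?gt_eqF// lerDl.
have kN : (N <= k + N)%N by rewrite leq_addl.
rewrite addSn exprS mulrCA.
apply: le_trans (ler_wpM2l (ltW Q0) IHk).
have := rM _ kN; have := ler_wpM2r (r0 _ kN) MQ; lra.
Qed.

(** By convexity of [t]^ (- p)[, each step raises]r n [^ (- p)] by at least [p * M]; this linear
    growth is then inverted. For [n] beyond [2 * N], [n - N] is at least [n / 2], whence the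
    constant [p * M / 2]. *)
Lemma sublinear_rate r M p (N : nat) : 0 < M -> 0 < p ->
  (forall n, (N <= n)%N -> 0 <= r n) ->
  (forall n, (N <= n)%N -> M * r n `^ (1 + p) <= r n - r n.+1) ->
  exists b, 0 < b /\
    forall n, (N.*2 < n)%N -> r n <= b * n%:R `^ (- (1 / p)).
Proof.
move=> M0 p0 r0 rM.
have inv_ge k : 0 < r (k + N)%N -> p * M * k%:R <= r (k + N)%N `^ (- p).
  elim: k => [|k IHk]; first by rewrite mulr0 powR_ge0.
  rewrite addSn => rS.
  have kN : (N <= k + N)%N by rewrite leq_addl.
  have rk : 0 < r (k + N)%N.
    apply: lt_le_trans rS _; rewrite -subr_ge0; apply: le_trans (rM _ kN).
    by rewrite mulr_ge0 ?powR_ge0// ltW.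
  have := powRN_convex_sub p _ _ (ltW p0) rk rS.
  have := ler_wpM2l (ltW p0) (rM _ kN) => h1 /(le_trans h1).
  rewrite mulrA [leRHS]mulrC ler_pM2r ?powR_gt0// -natr1.
  have := IHk rk; lra.
have pM0 : 0 < p * M / 2 by rewrite divr_gt0// mulr_gt0.
exists ((p * M / 2) `^ (- (1 / p))); split; first exact: powR_gt0.
move=> n Nn; have nN : (N <= n)%N by lia.
have := r0 n nN; rewrite le_eqVlt => /predU1P[<-|rn].
  by rewrite mulr_ge0 ?powR_ge0.
have n0 : 0 < n%:R :> R by rewrite ltr0n; lia.
have h : p * M / 2 * n%:R <= r n `^ (- p).
  have := inv_ge (n - N)%N; rewrite subnK// => /(_ rn); apply: le_trans.
  rewrite -!mulrA !ler_pM2l// natrB//.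
  have : N.*2%:R <= n%:R :> R by rewrite ler_nat ltnW.
  rewrite -muln2 natrM; lra.
have rE : r n = ((r n `^ (- p)) `^ (1 / p))^-1.
  by rewrite -powRrM -powRN mulrA mulr1 mulNr opprK divff ?gt_eqF// powRr1// ltW.
rewrite -(powRM _ (ltW pM0) (ltW n0)) {}rE [leRHS]powRN.
have pMn0 : 0 < p * M / 2 * n%:R by rewrite mulr_gt0.
rewrite lef_pV2 ?posrE ?powR_gt0//.
by apply: ge0_ler_powR; rewrite ?nnegrE ?divr_ge0 ?powR_ge0// ltW.
Qed.

Lemma powRD_le2 (theta a b : R) : 0 <= theta <= 1 -> 0 <= a -> 0 <= b ->
  (a + b) `^ theta <= 2 * (a `^ theta + b `^ theta).
Proof.
move=> /andP[th0 th1].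
wlog ab : a b / a <= b => [hwlog a0 b0|a0 b0].
  have [ab|/ltW ba] := leP a b; first exact: hwlog.
  by rewrite addrC [in leRHS]addrC; apply: hwlog.
have two : 2 `^ theta <= 2 :> R by apply: ler1_powR; rewrite ?ler1n.
apply: (@le_trans _ _ ((2 * b) `^ theta)).
  by apply: ge0_ler_powR; rewrite ?nnegrE ?addr_ge0 ?mulr_ge0//
    mulr2n mulrDl !mul1r lerD2r.
rewrite powRM//; apply: ler_pM; rewrite ?powR_ge0//.
by rewrite lerDr powR_ge0.
Qed.

(** From [N] on, [E] is nonincreasing and bounded below, hence convergent; its consecutive
    differences tend to 0 and dominate [w]. *)
Lemma vanishing_of_decrease (E w : nat -> R) lb N :
  (forall n, (N <= n)%N -> lb <= E n) ->
  (forall n, 0 <= w n) ->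
  (forall n, (N <= n)%N -> w n <= E n - E n.+1) ->
  forall e, 0 < e -> exists M : nat, forall n, (M <= n)%N -> w n < e.
Proof.
move=> Elb w0 wE e e0; pose F n := E (n + N)%N.
have FS : nonincreasing_seq F.
  apply/nonincreasing_seqP => n; rewrite /F addSn -subr_ge0.
  by apply: le_trans (w0 _) (wE _ _); rewrite leq_addl.
have Fcvg : cvgn F.
  apply: nonincreasing_is_cvgn => //; exists lb => _ [n _ <-].
  by apply: Elb; rewrite leq_addl.
have dF : (fun n => F n - F n.+1) @ \oo --> 0.
  rewrite -(subrr (limn F)); apply: cvgB => //.
  by have := Fcvg; rewrite -cvg_shiftS.
have [M _ MP] : \forall n \near \oo, F n - F n.+1 < e by exact: cvgr_lt dF _ e0.
exists (M + N)%N => n Mn; apply: le_lt_trans (wE n _) _; first by lia.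
have := MP (n - N)%N; rewrite /F /= addSn subnK; last by lia.
by apply; rewrite /=; lia.
Qed.

Lemma cvg_inertia (alpha beta : R) : 0 < alpha ->
  (fun n => beta * n%:R / (n%:R + alpha)) @ \oo --> beta.
Proof.
move=> a0.
have -> : (fun n => beta * n%:R / (n%:R + alpha))
    = (fun n : nat => beta - beta * alpha * (n%:R + alpha)^-1) :> (nat -> R).
  apply/funext => n; field.
  by rewrite gt_eqF// ltr_wpDl.
rewrite -[X in _ --> X]subr0 -(mulr0 (beta * alpha)).
apply: cvgB; first exact: cvg_cst.
apply: cvgMr; apply/gtr0_cvgV0; first by apply: nearW => n; rewrite ltr_wpDl.
apply/cvgryPge => A; have /cvgryPge/(_ (A - alpha)) := @cvgr_idn R.
by apply: filterS => n; rewrite lerBlDr.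
Qed.

End RealSequences.

(** * Finite length of the trajectory *)

Section Trapping.
Context {R : realType} {m : nat}.
Implicit Types (x y : nat -> 'rV[R]_m) (xs : 'rV[R]_m).

Lemma path_bound x (f : nat -> R) n j :
  (forall i, (i < j)%N ->
     enorm (x (n + i).+1 - x (n + i)%N) <= f (n + i)%N - f (n + i).+1) ->
  enorm (x (n + j)%N - x n) <= f n - f (n + j)%N.
Proof.
elim: j => [_|j IHj step].
  by rewrite addn0 !subrr -(scale0r 0) enormZ normr0 mul0r.
rewrite addnS; apply: le_trans (enorm_dist_trans (x (n + j)%N) _ _) _.
have := IHj (fun i ij => step i (ltnW ij)); have := step j (ltnSn j); lra.
Qed.

Lemma trapping x y xs (D r : nat -> R) N c C theta eps :
  0 < c -> 0 < C -> 0 <= theta < 1 -> 0 < eps ->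
  (forall n, 0 <= D n) ->
  (forall n, enorm (x n.+1 - x n) <= D n.+1) ->
  (forall n, enorm (y n - x n) <= D n) ->
  (forall n, (N <= n)%N -> 0 <= r n) ->
  (forall n, (N <= n)%N -> c * (D n + D n.+1) ^+ 2 <= r n - r n.+1) ->
  (forall n, (N <= n)%N -> enorm (y n - xs) < eps ->
     r n `^ theta <= C * (D n + D n.+1)) ->
  (forall e M, 0 < e ->
     exists n, [/\ (M <= n)%N, r n < e & enorm (x n - xs) < e]) ->
  exists n0, (N <= n0)%N /\ forall n, (n0 <= n)%N ->
    [/\ enorm (y n - xs) < eps,
        enorm (x n - xs) <= C / (c * (1 - theta)) * r n `^ (1 - theta)
      & D n <= C / (c * (1 - theta)) * r n `^ (1 - theta)].
Proof.
move=> c0 C0 th01 eps0 D0 Dx Dy r0 rD rth freq.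
have th1 : 0 < 1 - theta by lra.
set H := C / _.
have H0 : 0 < H by rewrite divr_gt0 ?mulr_gt0.
pose f n := H * r n `^ (1 - theta).
have f0 n : 0 <= f n by rewrite mulr_ge0 ?powR_ge0// ltW.
pose e4 := eps / 4.
have e40 : 0 < e4 by rewrite divr_gt0.
have e40' := mulr_gt0 c0 (exprn_gt0 2 e40).
have eH0 : 0 < (e4 / H) `^ (1 - theta)^-1 by apply/powR_gt0/divr_gt0.
(* The three bounds make the starting distance, every later [D n] (through [c * D n ^+ 2 <= r n])
   and the potential [f n0] each smaller than [eps / 4]. *)
pose e := Num.min e4 (Num.min (c * e4 ^+ 2) ((e4 / H) `^ (1 - theta)^-1)).
have e0 : 0 < e by rewrite /e !lt_min; apply/and3P; split.
have [n0 [Nn0 rn0 xn0]] := freq e N e0.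
move: rn0 xn0; rewrite !lt_min => /and3P[_ rn0 rn0'] /andP[xn0 _].
have fn0 : f n0 < e4.
  rewrite /f mulrC -ltr_pdivlMr//.
  have eHge0 : 0 <= e4 / H by rewrite ltW// divr_gt0.
  have -> : e4 / H = ((e4 / H) `^ (1 - theta)^-1) `^ (1 - theta).
    by rewrite -powRrM mulVf ?gt_eqF// powRr1.
  by apply: gt0_ltr_powR; rewrite ?nnegrE ?r0 ?(ltW eH0).
have r_le n : (n0 <= n)%N -> r n <= r n0.
  move=> /subnK <-; elim: (n - n0)%N => [//|k IHk].
  rewrite addSn; apply: le_trans IHk; rewrite -subr_ge0.
  have kN : (N <= k + n0)%N by rewrite (leq_trans Nn0)// leq_addl.
  by apply: le_trans (rD _ kN); rewrite mulr_ge0 ?sqr_ge0 ?(ltW c0).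
have Dlt n : (n0 <= n)%N -> D n < e4.
  move=> n0n; rewrite -(@ltr_pXn2r _ 2) ?nnegrE ?(ltW e40)//.
  rewrite -(ltr_pM2l c0); apply: le_lt_trans rn0; apply: le_trans (r_le _ n0n).
  have Nn := leq_trans Nn0 n0n.
  have := rD n Nn; have := r0 n.+1 (leqW Nn).
  have : D n ^+ 2 <= (D n + D n.+1) ^+ 2.
    by rewrite ler_pXn2r ?nnegrE ?addr_ge0// lerDl.
  move/(ler_wpM2l (ltW c0)); lra.
have step n : (n0 <= n)%N -> enorm (y n - xs) < eps ->
    D n + D n.+1 <= f n - f n.+1.
  move=> n0n yn; have Nn := leq_trans Nn0 n0n.
  rewrite -mulrBr; apply: length_step => //; rewrite ?addr_ge0 ?r0 ?leqW//.
  - exact: rD.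
  - exact: rth.
have stepx n : (n0 <= n)%N -> enorm (y n - xs) < eps ->
    enorm (x n.+1 - x n) <= f n - f n.+1.
  move=> n0n yn; have := step n n0n yn; have := Dx n; have := D0 n; lra.
(* Strong induction: the path from [n0] to [n0 + j] only uses steps already known to be in the ball,
   and the three quantities add up to less than [eps]. *)
have trap j : enorm (y (n0 + j)%N - xs) < eps.
  elim/ltn_ind: j => j IHj.
  have := @path_bound x f n0 j (fun i ij => stepx _ (leq_addr _ _) (IHj i ij)).
  have := f0 (n0 + j)%N; have := Dlt (n0 + j)%N (leq_addr _ _).
  have := Dy (n0 + j)%N.
  have := enorm_dist_trans (x (n0 + j)%N) (y (n0 + j)%N) xs.
  have := enorm_dist_trans (x n0) (x (n0 + j)%N) xs.
  have : eps = 4 * e4 by rewrite /e4; lra.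
  lra.
exists n0; split => // n n0n; rewrite -/(f n).
have trapn k : enorm (y (n + k)%N - xs) < eps.
  by rewrite -(subnKC n0n) -addnA; exact: trap.
have trap0 := trapn 0; rewrite addn0 in trap0.
split => //; last first.
  have := step n n0n trap0; have := D0 n.+1; have := f0 n.+1; lra.
(* Compare with a later [x k] within [e'] of [xs]; the path from [n] to [k] has length at most
   [f n]. *)
apply/ler_addgt0Pr => e' e'0.
have [k [nk _ xk]] := freq e' n e'0.
have := @path_bound x f n (k - n)%N
  (fun i _ => stepx _ (leq_trans n0n (leq_addr _ _)) (trapn i)).
rewrite subnKC// enorm_distC; have := f0 k.
have := enorm_dist_trans (x k) (x n) xs; lra.
Qed.

End Trapping.

(** * Lyapunov function *)

Section QuadraticBound.
Context {R : realType} {m : nat}.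

(* Coefficients of |d_{n+1}|^2 and |d_n|^2 in the bound on g(y_{n+1}) - g(y_n),
   with t = 1/s, p = beta_{n+1} and q = beta_n. *)
Definition coef_new (L t p q : R) :=
  L / 2 * (1 + p) ^+ 2 - (1 + p) * t + q / 2 * ((2 + p) * t - L * (1 + p)).
Definition coef_old (L t p q : R) :=
  L / 2 * q ^+ 2 - q ^+ 2 * t + q / 2 * ((2 + p) * t - L * (1 + p)).

(** The sum collapses to [L / 2 - (1 - beta) * t]. *)
Lemma coef_lt0 (L t beta : R) : L < 2 * (1 - beta) * t ->
  coef_new L t beta beta + coef_old L t beta beta < 0.
Proof. rewrite /coef_new /coef_old; lra. Qed.

(** Twice the difference is [(1 + 2 * beta) * (2 * (1 - beta) * t - L) + 2 * beta ^+ 2 * t]. It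
    makes the weight [delta] of the energy positive. *)
Lemma coef_new_lt_old (L t beta : R) : 0 < beta -> 0 < t -> L < 2 * (1 - beta) * t ->
  coef_new L t beta beta < coef_old L t beta beta.
Proof.
move=> be0 t0 hL; rewrite /coef_new /coef_old -subr_gt0.
have := mulr_gt0 (exprn_gt0 2 be0) t0.
have : 0 < (1 + 2 * beta) * (2 * (1 - beta) * t - L) by rewrite mulr_gt0; lra.
lra.
Qed.

(** After expansion, [dot u v] has coefficient [q * ((2 + p) * t - L * (1 + p))]. It is nonnegative
    since [p <= beta] and [L < 2 * (1 - beta) * t], so [2 * dot u v] may be replaced by the sum of
    the squared norms. *)
Lemma quadratic_bound (L t beta p q : R) (u v : 'rV[R]_m) :
  0 <= p <= beta -> 0 <= q -> 0 < t -> L < 2 * (1 - beta) * t ->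
  dot (t *: (q *: v - u)) ((1 + p) *: u - q *: v)
    + L / 2 * enorm ((1 + p) *: u - q *: v) ^+ 2
  <= coef_new L t p q * enorm u ^+ 2 + coef_old L t p q * enorm v ^+ 2.
Proof.
move=> /andP[p0 p1] q0 t0 hL.
have cross : 0 <= q * ((2 + p) * t - L * (1 + p)).
  apply: mulr_ge0 => //.
  have : 0 <= (1 + p) * (2 * (1 - beta) * t - L) by rewrite mulr_ge0; lra.
  have : 0 <= beta * p by rewrite mulr_ge0; lra.
  have : 0 <= beta by lra.
  move=> h1 /(mulr_ge0 (ltW t0)) h2; have := mulr_ge0 (ltW t0) h1.
  have : 0 <= t * (beta - p) by rewrite mulr_ge0; lra.
  lra.
have uv : 2 * dot v u <= dot v v + dot u u.
  by have := dot_ge0 (v - u); rewrite !dotE (dotC u v); lra.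
rewrite !sqr_enorm !dotE (dotC u v) /coef_new /coef_old.
have := ler_wpM2l cross uv; lra.
Qed.

End QuadraticBound.

(** * Energy descent along the iteration *)

Section Lyapunov.
Context {R : realType} {m : nat} {g : 'rV[R]_m -> R} {Lg alpha beta s : R}
  {xm1 : 'rV[R]_m} {x y : nat -> 'rV[R]_m}.
Hypothesis g_diff : forall z, differentiable g z.
Hypothesis g_lip : lipschitz_gradient g Lg.
Hypothesis alpha_gt0 : 0 < alpha.
Hypothesis beta01 : 0 < beta < 1.
Hypothesis s_gt0 : 0 < s.
Hypothesis s_lt : 0 < Lg -> s < 2 * (1 - beta) / Lg.
Hypothesis yE : forall n : nat,
  y n = x n + (beta * n%:R / (n%:R + alpha)) *: (x n - delay xm1 x n).
Hypothesis xE : forall n : nat, x n.+1 = y n - s *: gradient g (y n).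

Let b n : R := beta * n%:R / (n%:R + alpha).
Let d n := x n - delay xm1 x n.
Let D n := enorm (d n).

Lemma inertia_itv n : 0 <= b n <= beta.
Proof.
have /andP[be0 _] := beta01; have n0 : 0 <= n%:R :> R by [].
rewrite /b divr_ge0 ?mulr_ge0 ?addr_ge0 ?(ltW be0) ?(ltW alpha_gt0)//=.
by rewrite ler_pdivrMr ?ltr_wpDl// ler_pM2l// lerDl ltW.
Qed.

(** Both sides are [y n - x n.+1]. This expresses the gradient through two consecutive increments,
    for the Lojasiewicz inequality and for the descent estimate alike. *)
Lemma step_gradient n : s *: gradient g (y n) = b n *: d n - d n.+1.
Proof.
have yd : b n *: d n = y n - x n by rewrite yE addrC addKr.
have gd : s *: gradient g (y n) = y n - x n.+1 by rewrite xE subKr.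
by rewrite gd yd /d /= opprB addrA subrK.
Qed.

Lemma extrapolation_step n :
  y n.+1 - y n = (1 + b n.+1) *: d n.+1 - b n *: d n.
Proof.
rewrite !yE opprD addrA; congr (_ - _).
by rewrite scalerDl scale1r addrAC.
Qed.

Lemma enorm_extrapolation_le n : enorm (y n - x n) <= D n.
Proof.
have /andP[b0 b1] := inertia_itv n; have /andP[_ be1] := beta01.
rewrite yE addrC addKr enormZ ger0_norm// ler_piMl ?enorm_ge0//.
by rewrite (le_trans b1)// ltW.
Qed.

Lemma enorm_gradient_le n : enorm (gradient g (y n)) <= (D n + D n.+1) / s.
Proof.
rewrite ler_pdivlMr// mulrC -[X in X * _](gtr0_norm s_gt0) -enormZ.
rewrite step_gradient; apply: le_trans (enormB _ _) _; rewrite lerD2r.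
have -> : b n *: d n = y n - x n by rewrite yE addrC addKr.
exact: enorm_extrapolation_le.
Qed.

Lemma step_bound : Lg < 2 * (1 - beta) * s^-1.
Proof.
have /andP[_ be1] := beta01.
have [L0 _] := g_lip; rewrite ltr_pdivlMr//.
move: L0; rewrite le_eqVlt => /predU1P[<-|L0].
  by rewrite mul0r; lra.
by have := s_lt L0; rewrite ltr_pdivlMr// mulrC.
Qed.

Lemma value_step n :
  g (y n.+1) <= g (y n) + coef_new Lg s^-1 (b n.+1) (b n) * D n.+1 ^+ 2
                        + coef_old Lg s^-1 (b n.+1) (b n) * D n ^+ 2.
Proof.
have gE : gradient g (y n) = s^-1 *: (b n *: d n - d n.+1).
  by rewrite -step_gradient scalerA mulVf ?scale1r// gt_eqF.
have := descent g_diff Lg (y n) (y n.+1) g_lip.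
rewrite extrapolation_step gE.
have /andP[p0 p1] := inertia_itv n.+1; have /andP[q0 q1] := inertia_itv n.
have t0 : 0 < s^-1 by rewrite invr_gt0.
have hs := step_bound; have [L0 _] := g_lip.
have := quadratic_bound Lg s^-1 beta _ _ (d n.+1) (d n) (inertia_itv n.+1) q0 t0 hs.
rewrite -/(D n) -/(D n.+1); lra.
Qed.

(** As the inertia tends to [beta], the two coefficients tend to [A] and [B]. With
    [delta = (B - A) / 2], both [A + delta] and [B - delta] equal [(A + B) / 2 < 0]. Half of this
    margin absorbs the convergence error; the other half, by [(a + b)^2 <= 2 * (a^2 + b^2)], yields
    [c = - (A + B) / 8]. *)
Lemma energy_decrease : exists delta c (N : nat), [/\ 0 < delta, 0 < c &
  forall n, (N <= n)%N ->
    g (y n.+1) + delta * D n.+1 ^+ 2 + c * (D n + D n.+1) ^+ 2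
      <= g (y n) + delta * D n ^+ 2].
Proof.
have /andP[be0 be1] := beta01.
have t0 : 0 < s^-1 by rewrite invr_gt0.
have hs := step_bound.
set t := s^-1 in t0 hs *.
pose A := coef_new Lg t beta beta; pose B := coef_old Lg t beta beta.
have AB : A + B < 0 := coef_lt0 _ _ _ hs.
have ltAB : A < B := coef_new_lt_old _ _ _ be0 t0 hs.
have cb : b @ \oo --> beta by exact: cvg_inertia.
have cbS : (fun n => b n.+1) @ \oo --> beta by have := cb; rewrite -cvg_shiftS.
have cA : (fun n => coef_new Lg t (b n.+1) (b n)) @ \oo --> A.
  by rewrite /A /coef_new; repeat first [exact: cvg_cst | exact: cb | exact: cbS
    | apply: cvgB | apply: cvgD | apply: cvgM].
have cB : (fun n => coef_old Lg t (b n.+1) (b n)) @ \oo --> B.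
  by rewrite /B /coef_old; repeat first [exact: cvg_cst | exact: cb | exact: cbS
    | apply: cvgB | apply: cvgD | apply: cvgM].
have ltA : A < A - (A + B) / 4 by lra.
have ltB : B < B - (A + B) / 4 by lra.
have [N1 _ NA] := cvgr_lt A cA _ ltA.
have [N2 _ NB] := cvgr_lt B cB _ ltB.
exists ((B - A) / 2), (- (A + B) / 8), (maxn N1 N2); split; [lra|lra|].
move=> n; rewrite geq_max => /andP[n1 n2].
have := value_step n; have := NA n n1; have := NB n n2; rewrite /= -/t.
move=> /ltW/(ler_wpM2r (sqr_ge0 (D n))) hB /ltW/(ler_wpM2r (sqr_ge0 (D n.+1))) hA.
have AB0 : 0 <= - (A + B) / 8 by lra.
have := mulr_ge0 AB0 (sqr_ge0 (D n - D n.+1)).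
clearbody A B; lra.
Qed.

(** * Energy estimates near the cluster point *)

Hypothesis g_lbound : has_lbound (range g).
Context {xs : 'rV[R]_m} {theta : R}.
Hypothesis xs_omega : cluster_points x xs.
Hypothesis g_loj : lojasiewicz_exponent g xs theta.
Hypothesis theta_itv : 1 / 2 <= theta < 1.

(** Collects what both regimes share: a recursion for the energy gap [r], and bounds of all four
    target quantities by powers of [r]. *)
Lemma energy_rates : exists (r : nat -> R) (K M : R) (N : nat), [/\ 0 < K, 0 < M &
  forall n, (N <= n)%N ->
   [/\ 0 <= r n, M * r n `^ (2 * theta) <= r n - r n.+1,
       g (y n) - g xs <= K * r n, g (x n) - g xs <= K * r n &
       enorm (x n - xs) <= K * r n `^ (1 - theta) /\
       enorm (y n - xs) <= K * r n `^ (1 - theta)]].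
Proof.
have [delta [c [N [delta0 c0 dec]]]] := energy_decrease.
have [L0 _] := g_lip.
have [_ gxs0 _ [K [eps [K0 eps0 loj]]]] := g_loj.
have D0 n : 0 <= D n by exact: enorm_ge0.
have yxD := enorm_extrapolation_le.
pose E n := g (y n) + delta * D n ^+ 2.
pose r n := E n - g xs.
have rD n : (N <= n)%N -> c * (D n + D n.+1) ^+ 2 <= r n - r n.+1.
  by move=> /dec; rewrite /r /E; lra.
have r_le k n : (N <= n)%N -> r (k + n)%N <= r n.
  move=> Nn; elim: k => // k IHk; apply: le_trans IHk.
  rewrite addSn -subr_ge0; apply: le_trans (rD _ _).
    by rewrite mulr_ge0 ?sqr_ge0// ltW.
  by rewrite (leq_trans Nn)// leq_addl.
have Dsmall e : 0 < e -> exists M, forall n, (M <= n)%N -> D n < e.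
  move=> e0; have [lb glb] := g_lbound.
  have [|||M MP] := @vanishing_of_decrease R r
    (fun n => c * (D n + D n.+1) ^+ 2) (lb - g xs) N _ _ rD (c * e ^+ 2).
  - move=> n _; rewrite /r /E lerB// ler_wpDr ?mulr_ge0 ?sqr_ge0 ?(ltW delta0)//.
    by apply: glb; exists (y n).
  - by move=> n; rewrite mulr_ge0 ?sqr_ge0// ltW.
  - by rewrite mulr_gt0// exprn_gt0.
  exists M => n /MP; rewrite ltr_pM2l// ltr_pXn2r ?nnegrE ?addr_ge0 ?(ltW e0)//.
  by apply: le_lt_trans; rewrite lerDl.
(* Along the subsequence [x] is near [xs] and [D] is small, so [y] is within [2 * e1] of [xs]. Then
   [critical_growth] bounds the value gap by [6 * Lg * e1 ^+ 2], and the kinetic term is at most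
   [delta * e1 ^+ 2]; as [e1 <= 1], both squares are at most [e1], which explains [T]. *)
have freq e M : 0 < e ->
    exists n, [/\ (M <= n)%N, `|r n| < e & enorm (x n - xs) < e].
  move=> e0; have [phi [phi_inc phi_cvg]] := xs_omega.
  have phi_ge k : (k <= phi k)%N.
    by elim: k => // k IHk; apply: leq_ltn_trans IHk (phi_inc _ _ (ltnSn k)).
  pose T := 6 * Lg + delta + 1.
  have T0 : 0 < T by rewrite /T; lra.
  pose e1 := Num.min e (Num.min 1 (e / T)).
  have e10 : 0 < e1 by rewrite !lt_min e0 ltr01 divr_gt0.
  have [k0 _ k0P] := cvg_enorm _ _ phi_cvg e1 e10.
  have [M1 M1P] := Dsmall e1 e10.
  pose k := maxn k0 (maxn M M1).
  have [kk kM kM1] : [/\ (k0 <= k)%N, (M <= k)%N & (M1 <= k)%N].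
    by rewrite /k !leq_max !leqnn !orbT.
  exists (phi k); split; first exact: leq_trans kM (phi_ge k).
    have dx := k0P k kk; have dD := M1P _ (leq_trans kM1 (phi_ge k)).
    have := enorm_dist_trans (x (phi k)) (y (phi k)) xs.
    have := yxD (phi k).
    have := critical_growth g_diff Lg xs (y (phi k)) g_lip gxs0.
    have e11 : e1 <= 1 by rewrite /e1 !ge_min lexx orbT.
    have Te1 : e1 * T <= e.
      by rewrite -ler_pdivlMr// /e1 !ge_min lexx !orbT.
    rewrite /= in dx; move=> hg hyx htr.
    have yle : enorm (y (phi k) - xs) <= 2 * e1 by lra.
    have e1sq : e1 ^+ 2 <= e1 by rewrite expr2 ler_piMr// ltW.
    have ysq : enorm (y (phi k) - xs) ^+ 2 <= 4 * e1.
      apply: (@le_trans _ _ ((2 * e1) ^+ 2)); last by rewrite exprMn; lra.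
      by rewrite ler_pXn2r ?nnegrE ?enorm_ge0// mulr_ge0// ltW.
    have Dsq : D (phi k) ^+ 2 <= e1.
      by apply: le_trans e1sq; rewrite ler_pXn2r ?nnegrE ?(ltW e10)// ltW.
    have := ler_wpM2l L0 ysq; have := ler_wpM2l (ltW delta0) Dsq => hd hl.
    have rE : r (phi k) = (g (y (phi k)) - g xs) + delta * D (phi k) ^+ 2.
      by rewrite /r /E addrAC.
    have := ler_normD (g (y (phi k)) - g xs) (delta * D (phi k) ^+ 2).
    rewrite -rE (ger0_norm (mulr_ge0 (ltW delta0) (sqr_ge0 _))).
    have : (6 * Lg + delta) * e1 < e1 * T by rewrite mulrC ltr_pM2l// /T ltrDl.
    clearbody r e1 T; lra.
  by apply: lt_le_trans (k0P k kk) _; rewrite ge_min lexx.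
(* A negative value would persist by monotonicity, contradicting the indices where the absolute
   value of [r] is arbitrarily small. *)
have r0 n : (N <= n)%N -> 0 <= r n.
  move=> Nn; rewrite leNgt; apply/negP => rn0.
  have rn0' : 0 < - r n by lra.
  have [k [nk rk _]] := freq _ n rn0'.
  have := r_le (k - n)%N n Nn; rewrite subnK//.
  by move: rk; rewrite ltr_norml; lra.
have /andP[th12 th1] := theta_itv.
have [M1 M1P] := Dsmall 1 ltr01.
pose C := 2 * (K / s + delta `^ theta).
have C0 : 0 < C.
  have : 0 < K / s by rewrite divr_gt0.
  by have := powR_gt0 theta delta0; rewrite /C; lra.
have rth n : (maxn N M1 <= n)%N -> enorm (y n - xs) < eps ->
    r n `^ theta <= C * (D n + D n.+1).
  rewrite geq_max => /andP[Nn M1n] yn.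
  have Dn1 : D n <= 1 by rewrite ltW// M1P.
  have gradn := enorm_gradient_le n.
  (* Here [1 / 2 <= theta] enters: [D n <= 1] and the exponent [2 * theta] is at least 1. *)
  have DD : (D n ^+ 2) `^ theta <= D n.
    have := D0 n; rewrite le_eqVlt => /predU1P[<-|Dn0].
      by rewrite expr0n powR0// gt_eqF//; lra.
    rewrite -powR_mulrn// -powRrM; apply: ge1r_powR; first by rewrite Dn0.
    by lra.
  apply: (@le_trans _ _ ((`|g (y n) - g xs| + delta * D n ^+ 2) `^ theta)).
    have dD0 := mulr_ge0 (ltW delta0) (sqr_ge0 (D n)).
    apply: ge0_ler_powR; rewrite ?nnegrE ?(r0 n Nn) ?(addr_ge0 _ dD0)//; first by lra.
    by rewrite /r /E addrAC lerD2r ler_norm.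
  apply: le_trans (powRD_le2 _ _ _ _ _ _) _ => //; first by lra.
    by rewrite mulr_ge0 ?sqr_ge0// ltW.
  rewrite /C -mulrA ler_pM2l// mulrDl lerD//.
    apply: le_trans (loj _ yn) _; rewrite -mulrA ler_pM2l//.
    by rewrite mulrC.
  rewrite powRM ?sqr_ge0 ?(ltW delta0)// ler_pM2l ?powR_gt0//.
  by apply: le_trans DD _; rewrite lerDl.
have th01 : 0 <= theta < 1 by lra.
have freq' e M : 0 < e ->
    exists n, [/\ (M <= n)%N, r n < e & enorm (x n - xs) < e].
  move=> e0; have [n [Mn rn xn]] := freq e M e0.
  by exists n; split => //; exact: le_lt_trans (ler_norm _) rn.
have [n0 [Nn0 trap]] := @trapping R m x y xs D r (maxn N M1) c C theta eps
  c0 C0 th01 eps0 D0 (fun n => lexx _) yxD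
  (fun n Nn => r0 n (leq_trans (leq_maxl _ _) Nn))
  (fun n Nn => rD n (leq_trans (leq_maxl _ _) Nn)) rth
  freq'.
clearbody C; move: trap; set H := C / _ => trap.
have H0 : 0 < H by apply: divr_gt0 => //; apply: mulr_gt0 => //; rewrite subr_gt0.
(* Descent from [y n] to [x n] costs at most [(s^-1 + Lg / 2) * (D n + D n.+1) ^+ 2], hence at most
   [G * r n]. *)
pose G := (s^-1 + Lg / 2) / c.
have sV0 : 0 < s^-1 by rewrite invr_gt0.
have G0 : 0 <= G by rewrite divr_ge0 ?addr_ge0 ?divr_ge0 ?(ltW c0)// ltW.
exists r, (1 + G + 2 * H), (c / C ^+ 2), n0; split.
- lra.
- by rewrite divr_gt0// exprn_gt0.
move=> n n0n; have [yn xn Dn] := trap n n0n.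
have Nn : (N <= n)%N by rewrite (leq_trans (leq_maxl N M1))// (leq_trans Nn0).
have rn := r0 n Nn.
have u0 : 0 <= D n + D n.+1 by rewrite addr_ge0.
have gradn := enorm_gradient_le n.
have gy : g (y n) - g xs <= r n.
  by rewrite /r /E lerB// lerDl mulr_ge0 ?sqr_ge0// ltW.
have Hn : 0 <= H * r n `^ (1 - theta) by rewrite mulr_ge0 ?powR_ge0// ltW.
have Gn : 0 <= (1 + G) * r n `^ (1 - theta).
  by rewrite mulr_ge0 ?powR_ge0// addr_ge0.
split => //.
- rewrite mulrAC ler_pdivrMr ?exprn_gt0//.
  have : (r n `^ theta) ^+ 2 <= (C * (D n + D n.+1)) ^+ 2.
    rewrite ler_pXn2r ?nnegrE ?powR_ge0 ?mulr_ge0 ?(ltW C0)//.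
    by apply: rth => //; exact: leq_trans n0n.
  rewrite -powR_mulrn ?powR_ge0// -powRrM [theta * _]mulrC exprMn.
  move/(ler_wpM2l (ltW c0)) => /le_trans; apply.
  rewrite mulrCA mulrC ler_pM2r ?exprn_gt0//; exact: rD.
- apply: le_trans gy _; rewrite ler_peMl//; lra.
- have := descent g_diff Lg (y n) (x n) g_lip.
  have := dot_le_enorm (gradient g (y n)) (x n - y n).
  rewrite enorm_distC.
  have u1 : enorm (y n - x n) <= D n + D n.+1.
    by apply: le_trans (yxD n) _; rewrite lerDl.
  have u2 : enorm (y n - x n) ^+ 2 <= (D n + D n.+1) ^+ 2.
    by rewrite ler_pXn2r ?nnegrE ?enorm_ge0.
  have := ler_pM (enorm_ge0 _) (enorm_ge0 _) gradn u1.
  have := ler_wpM2l L0 u2.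
  have : (s^-1 + Lg / 2) * (D n + D n.+1) ^+ 2 <= G * r n.
    rewrite mulrAC ler_pdivlMr// -mulrA ler_wpM2l ?addr_ge0 ?divr_ge0 ?(ltW sV0)//.
    by rewrite mulrC; apply: le_trans (rD n Nn) _; rewrite lerBlDr lerDl r0// leqW.
  have := mulr_ge0 (ltW H0) rn.
  move: gy; clearbody r H G D; lra.
split; first lra.
have := enorm_dist_trans (x n) (y n) xs; have := yxD n; lra.
Qed.
End Lyapunov.

(* The upper bound on s is read as +oo when Lg = 0, hence the guard 0 < Lg. *)
Theorem corollary22 (R : realType) (m : nat) (g : 'rV[R]_m -> R)
  (Lg alpha beta s : R) (xm1 : 'rV[R]_m) (x y : nat -> 'rV[R]_m)
  (xstar : 'rV[R]_m) (theta : R)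
  (g_diff : forall z, differentiable g z)
  (g_lip : lipschitz_gradient g Lg)
  (alpha_gt0 : 0 < alpha)
  (beta01 : 0 < beta < 1)
  (s_gt0 : 0 < s)
  (s_lt : 0 < Lg -> s < 2 * (1 - beta) / Lg)
  (yE : forall n : nat,
     y n = x n + (beta * n%:R / (n%:R + alpha)) *: (x n - delay xm1 x n))
  (xE : forall n : nat, x n.+1 = y n - s *: gradient g (y n))
  (g_lbound : has_lbound (range g))
  (omega_neq0 : cluster_points x !=set0)
  (xstar_omega : cluster_points x xstar)
  (g_loj : lojasiewicz_exponent g xstar theta)
  (theta_itv : 1 / 2 <= theta < 1) :
  (theta = 1 / 2 ->
     exists (Q a1 a2 a3 a4 : R) (kbar : nat),
       [/\ 0 <= Q < 1, [/\ 0 < a1, 0 < a2, 0 < a3 & 0 < a4]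
         & forall n : nat, (kbar <= n)%N ->
             [/\ g (y n) - g xstar <= a1 * Q ^+ n,
                 g (x n) - g xstar <= a2 * Q ^+ n,
                 enorm (x n - xstar) <= a3 * Q `^ (n%:R / 2)
               & enorm (y n - xstar) <= a4 * Q `^ (n%:R / 2)]])
  /\
  (1 / 2 < theta < 1 ->
     exists (b1 b2 b3 b4 : R) (kbar : nat),
       [/\ 0 < b1, 0 < b2, 0 < b3, 0 < b4
         & forall n : nat, (kbar <= n)%N ->
             [/\ g (y n) - g xstar <= b1 * n%:R `^ (- (1 / (2 * theta - 1))),
                 g (x n) - g xstar <= b2 * n%:R `^ (- (1 / (2 * theta - 1))),
                 enorm (x n - xstar)
                   <= b3 * n%:R `^ ((theta - 1) / (2 * theta - 1))
               & enorm (y n - xstar)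
                   <= b4 * n%:R `^ ((theta - 1) / (2 * theta - 1))]]).
Proof.
have [r [K [M [N [K0 M0 rates]]]]] := energy_rates g_diff g_lip alpha_gt0 beta01
  s_gt0 s_lt yE xE g_lbound xstar_omega g_loj theta_itv.
have r0 n : (N <= n)%N -> 0 <= r n by case/rates.
have rM n : (N <= n)%N -> M * r n `^ (2 * theta) <= r n - r n.+1 by case/rates.
have th1 : 0 <= 1 - theta by lra.
(* Turns a rate for [r] into a rate for the distances. *)
have le_root n A q : 0 < A -> 0 <= q -> (N <= n)%N -> r n <= A * q ->
    K * r n `^ (1 - theta) <= K * A `^ (1 - theta) * q `^ (1 - theta).
  move=> A0 q0 Nn rA; rewrite -mulrA ler_pM2l// -(powRM _ (ltW A0) q0).
  by apply: ge0_ler_powR; rewrite ?nnegrE ?r0 ?mulr_ge0// ltW.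
split=> [thE|/andP[th12 _]].
- have th2 : 2 * theta = 1 by lra.
  have rM1 n : (N <= n)%N -> M * r n <= r n - r n.+1.
    by move=> Nn; have := rM n Nn; rewrite th2 powRr1// r0.
  have [Q [a [/andP[Q0 Q1] a0 ra]]] := linear_rate r M N M0 r0 rM1.
  have Ka0 : 0 < K * a `^ (1 - theta) by rewrite mulr_gt0 ?powR_gt0.
  exists Q, (K * a), (K * a), (K * a `^ (1 - theta)), (K * a `^ (1 - theta)), N.
  split; first by rewrite (ltW Q0).
    by split => //; rewrite mulr_gt0.
  move=> n Nn; have [_ _ gy gx [xn yn]] := rates n Nn.
  have rn := ra n Nn; have := le_root n a (Q ^+ n) a0 (exprn_ge0 _ (ltW Q0)) Nn rn.
  rewrite -[Q ^+ n](powR_mulrn _ (ltW Q0)) -(powRrM Q).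
  have -> : n%:R * (1 - theta) = n%:R / 2 by rewrite thE; lra.
  rewrite (powR_mulrn _ (ltW Q0)) => root.
  have Kr : K * r n <= K * a * Q ^+ n by rewrite -mulrA ler_pM2l.
  by split; [exact: le_trans gy Kr | exact: le_trans gx Kr
    | exact: le_trans xn root | exact: le_trans yn root].
- have p0 : 0 < 2 * theta - 1 by lra.
  have rM1 n : (N <= n)%N -> M * r n `^ (1 + (2 * theta - 1)) <= r n - r n.+1.
    by rewrite [1 + _]addrC subrK; exact: rM.
  (* With [p = 2 * theta - 1], the energy rate has exponent [- (1 / p)]; raising it to the power
     [1 - theta] gives the exponent for the distances. The rate holds strictly beyond [2 * N], hence
     the threshold [N.*2.+1]. *)
  have [a [a0 ra]] := sublinear_rate r M _ N M0 p0 r0 rM1.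
  have Ka0 : 0 < K * a `^ (1 - theta) by rewrite mulr_gt0 ?powR_gt0.
  exists (K * a), (K * a), (K * a `^ (1 - theta)), (K * a `^ (1 - theta)), N.*2.+1.
  split=> //; try by rewrite mulr_gt0.
  move=> n Nn2; have Nn : (N <= n)%N.
    by apply: leq_trans Nn2; rewrite leqW// -addnn leq_addr.
  have [_ _ gy gx [xn yn]] := rates n Nn.
  have rn := ra n Nn2; have := le_root n a _ a0 (powR_ge0 _ _) Nn rn.
  rewrite -(powRrM n%:R).
  have -> : - (1 / (2 * theta - 1)) * (1 - theta) = (theta - 1) / (2 * theta - 1).
    by field; rewrite gt_eqF.
  move=> root.
  have Kr : K * r n <= K * a * n%:R `^ (- (1 / (2 * theta - 1))).
    by rewrite -mulrA ler_pM2l.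
  by split; [exact: le_trans gy Kr | exact: le_trans gx Kr
    | exact: le_trans xn root | exact: le_trans yn root].
Qed.
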